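(* Let $K\subset\mathbb{R}^3$ be a triangular prism with vertices $V_1,\dots,V_6$, faces $F_1,\dots,F_5$, face centroids $M_1,\dots,M_5$ and affine functions $\lambda_0,\lambda_4,\lambda_5$ as described in the context. Let $$Q_K=P_2(K)\oplus\mathrm{span}\{\lambda_0\lambda_4\lambda_5\},$$ and let $T_K=\{\tau_i:\ i=1,\dots,11\}$, where for $v\in Q_K$ $$\tau_i(v)=v(V_i),\ i=1,\dots,6,\qquad \tau_{i+6}(v)=\frac{\partial v}{\partial\boldsymbol{n}}(M_i),\ i=1,\dots,5,$$ with $\boldsymbol{n}$ the unit outward normal on $\partial K$. Then the finite element $(K,Q_K,T_K)$ is well-defined, i.e. $T_K$ is unisolvent for $Q_K$: for every $(\alpha_1,\dots,\alpha_{11})\in\mathbb{R}^{11}$ there exists exactly one $v\in Q_K$ with $\tau_i(v)=\alpha_i$ for all $i=1,\dots,11$.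
   Context: The prism $K$ is the product of a nondegenerate triangle in the $(x_1,x_2)$-variables and a nondegenerate interval in the $x_3$-variable. Its bottom face is $F_4=V_1V_2V_3$ and its top face is $F_5=V_4V_5V_6$, both parallel to the $x_1x_2$-plane, with the $x_3$-coordinate of $F_5$ greater than that of $F_4$, and $V_{i+3}$ lies directly above $V_i$ for $i=1,2,3$. The side faces, parallel to the $x_3$-axis, are the rectangles $F_1=V_2V_3V_6V_5$, $F_2=V_3V_1V_4V_6$, $F_3=V_1V_2V_5V_4$. $M_i$ is the centroid of $F_i$, $i=1,\dots,5$. $\lambda_4$ and $\lambda_5$ are the affine functions vanishing on the planes containing $F_4$ and $F_5$, respectively, normalized by $\lambda_4(M_1)=-\lambda_5(M_1)=1$; $\lambda_0$ is the affine function vanishing on the plane through $M_1,M_2,M_3$ with $\lambda_0(V_4)=-\lambda_0(V_1)=1$. (These three functions depend only on $x_3$.) $P_k(K)$ is the space of polynomials on $K$ of total degree at most $k$. *)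

(* Defs.v *)
From mathcomp Require Import all_boot all_order all_algebra.
From mathcomp Require Import reals.
From mathcomp Require Export mpoly.

Set Implicit Arguments.
Unset Strict Implicit.
Unset Printing Implicit Defensive.

Import Order.TTheory GRing.Theory Num.Theory.
Local Open Scope ring_scope.

(* Vertices, faces and functionals are indexed from 0, not from 1. *)

Record prism (R : realType) := Prism {
  base : 'I_3 -> 'rV[R]_2;
  zbot : R;
  ztop : R;
  base_nondegenerate :
    row_free (col_mx (base (inord 1) - base (inord 0))
                     (base (inord 2) - base (inord 0)));
  zbot_lt_ztop : zbot < ztop
}.

Section Prism.
Context {R : realType}.
Implicit Types (K : prism R) (x y : 'rV[R]_3) (p v l : {mpoly R[3]}).

Definition peval p x : R := p.@[x ord0].

Definition point3 (a : 'rV[R]_2) (z : R) : 'rV[R]_3 := row_mx a z%:M.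

Definition in_triangle (A : 'I_3 -> 'rV[R]_2) (a : 'rV[R]_2) : Prop :=
  exists t : 'I_3 -> R,
    [/\ forall j, 0 <= t j, \sum_j t j = 1 & a = \sum_j t j *: A j].

Definition in_prism K x : Prop :=
  exists a z, [/\ in_triangle (base K) a, zbot K <= z <= ztop K
                & x = point3 a z].

Definition vertex K (i : 'I_6) : 'rV[R]_3 :=
  match split (i : 'I_(3 + 3)) with
  | inl j => point3 (base K j) (zbot K)
  | inr j => point3 (base K j) (ztop K)
  end.

Definition face (i : 'I_5) : seq 'I_6 :=
  map inord
    (nth [::] [:: [:: 1; 2; 5; 4]; [:: 2; 0; 3; 5]; [:: 0; 1; 4; 3];
                  [:: 0; 1; 2]; [:: 3; 4; 5]]%N i).

(* For a triangle or a rectangle, the centroid is the mean of the vertices. *)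
Definition face_centroid K (i : 'I_5) : 'rV[R]_3 :=
  (size (face i))%:R^-1 *: \sum_(j <- face i) vertex K j.

Definition dot x y : R := \sum_k x ord0 k * y ord0 k.

(* As K is convex, n points outward on face i when K lies on the nonpositive *)
(* side of the plane of that face.                                           *)
Definition unit_outward_normal K (i : 'I_5) (n : 'rV[R]_3) : Prop :=
  [/\ {in face i &, forall j k, dot n (vertex K j - vertex K k) = 0},
      dot n n = 1
    & forall x, in_prism K x -> dot n (x - face_centroid K i) <= 0].

Definition normal_deriv v (n x : 'rV[R]_3) : R :=
  \sum_k n ord0 k * peval v^`M(k) x.

Definition in_plane (a b c x : 'rV[R]_3) : Prop :=
  exists s t : R, x = a + s *: (b - a) + t *: (c - a).

(* Total degree at most k: msize is one more than the degree, and 0 at 0.  As *)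
(* K has interior points, polynomials on K are identified with {mpoly R[3]}.  *)
Definition in_P (k : nat) p : Prop := (msize p <= k.+1)%N.

Definition is_lambda0 K l : Prop :=
  [/\ in_P 1 l,
      forall x, in_plane (face_centroid K (inord 0)) (face_centroid K (inord 1))
                         (face_centroid K (inord 2)) x -> peval l x = 0,
      peval l (vertex K (inord 3)) = 1
    & - peval l (vertex K (inord 0)) = 1].

Definition is_lambda4 K l : Prop :=
  [/\ in_P 1 l,
      forall x, in_plane (vertex K (inord 0)) (vertex K (inord 1))
                         (vertex K (inord 2)) x -> peval l x = 0
    & peval l (face_centroid K (inord 0)) = 1].

Definition is_lambda5 K l : Prop :=
  [/\ in_P 1 l,
      forall x, in_plane (vertex K (inord 3)) (vertex K (inord 4))
                         (vertex K (inord 5)) x -> peval l x = 0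
    & - peval l (face_centroid K (inord 0)) = 1].

Definition in_Q (l0 l4 l5 v : {mpoly R[3]}) : Prop :=
  exists p (c : R), in_P 2 p /\ v = p + c *: (l0 * l4 * l5).

Definition tau K (n : 'I_5 -> 'rV[R]_3) (i : 'I_11) v : R :=
  match split (i : 'I_(6 + 5)) with
  | inl j => peval v (vertex K j)
  | inr j => normal_deriv v (n j) (face_centroid K j)
  end.

Lemma msize_affine l x y :
  in_P 1 l -> peval l x != peval l y -> msize l = 2%N.
Proof.
rewrite /in_P /peval => l2 neq; apply/eqP; rewrite eqn_leq l2 ltnNge.
apply/negP => /msize1_polyC E; move: neq.
by rewrite E !mevalC eqxx.
Qed.

(* The sum defining Q_K is direct. *)
Lemma in_Q_direct K (l0 l4 l5 p q : {mpoly R[3]}) (c d : R) :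
    is_lambda0 K l0 -> is_lambda4 K l4 -> is_lambda5 K l5 ->
    in_P 2 p -> in_P 2 q ->
    p + c *: (l0 * l4 * l5) = q + d *: (l0 * l4 * l5) ->
  p = q /\ c = d.
Proof.
have plane0 (x y z : 'rV[R]_3) : in_plane x y z x.
  by exists 0, 0; rewrite !scale0r !addr0.
case=> d0 _ l0V3 l0V0 [d4 z4 l4M] [d5 z5 l5M] pP qP E.
have s0 : msize l0 = 2%N.
  apply: (msize_affine (x := vertex K (inord 3)) (y := vertex K (inord 0)) d0).
  apply/eqP=> e; move: l0V0; rewrite -e l0V3 => /eqP.
  by rewrite eq_sym -subr_eq0 opprK -mulr2n pnatr_eq0.
have s4 : msize l4 = 2%N.
  apply: (msize_affine (x := face_centroid K (inord 0))
                       (y := vertex K (inord 0)) d4).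
  by rewrite l4M (z4 _ (plane0 _ _ _)) oner_neq0.
have s5 : msize l5 = 2%N.
  apply: (msize_affine (x := face_centroid K (inord 0))
                       (y := vertex K (inord 3)) d5).
  by rewrite (z5 _ (plane0 _ _ _)) -oppr_eq0 l5M oner_neq0.
have nz (l : {mpoly R[3]}) : msize l = 2%N -> l != 0.
  by move=> s; apply/eqP=> l_0; rewrite l_0 msize0 in s.
have s045 : msize (l0 * l4 * l5) = 4%N.
  by rewrite !msizeM ?mulf_neq0 ?nz // s0 s4 s5.
have cd : c = d.
  apply/eqP; apply: contraTT isT => ncd.
  have S : (c - d) *: (l0 * l4 * l5) = q - p.
    apply/eqP; rewrite scalerBl subr_eq addrAC -E.
    by rewrite addrAC subrr add0r.
  have := msizeD_le q (- p); rewrite -S msizeN msizeZ ?subr_eq0 // s045.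
  by rewrite leqNgt gtn_max !ltnS qP pP.
by split=> //; move: E; rewrite cd => /addIr.
Qed.

End Prism.

(* Main.v *)
(* Let t_1, t_2, t_3 be the barycentric coordinates of the triangle and s the  *)
(* affine function of x_3 equal to -1 on F_4 and to 1 on F_5.  Evaluating      *)
(* affine functions gives lambda_0 = s, lambda_4 = s + 1, lambda_5 = s - 1, so *)
(* Q_K consists of the polynomials                                             *)
(*   sum_j b_j t_j + sum_j g_j t_j (1 - t_j) + s sum_j d_j t_j + e s^2         *)
(*     + c s (s + 1) (s - 1).                                                  *)
(* In these eleven coefficients the functionals are triangular.  The values at *)
(* V_j and V_(j+3) are b_j - d_j + e and b_j + d_j + e.  On the horizontal     *)
(* faces the normal derivative is a nonzero multiple of                        *)
(* (d_1 + d_2 + d_3) / 3 -+ 2 e + 2 c.  The normal derivative of t_j (1 - t_j) *)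
(* at M_k vanishes for k != j, as t_j(M_k) = 1/2, and is that of t_j, hence    *)
(* nonzero, for k = j.  So the functionals determine in turn d, then e and c,  *)
(* then b, then g.                                                             *)
Require Import Defs.
From mathcomp Require Import all_boot all_order all_algebra.
From mathcomp Require Import reals.
From mathcomp Require Import ring lra.

Set Implicit Arguments.
Unset Strict Implicit.
Unset Printing Implicit Defensive.

Import Order.TTheory GRing.Theory Num.Theory.
Local Open Scope ring_scope.

(** The barycentric coordinates [bary] and the vertical coordinate [vert] adapt the problem to the
    prism. An affine function has four coefficients in them ([affine_barycentric]), and the
    conditions on each lambda fix all four ([lambda0E], [lambda4E], [lambda5E]). Products of affine
    functions span the quadratics, so [in_Q_prism_poly] identifies Q_K with the family [prism_poly].

    On this family the functionals form a triangular system whose pivots are nonzero by the geometry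
    of the normals ([side_normal], [bottom_normal], [top_normal]). [prism_poly_unisolvent] solves it
    as an equivalence on coefficients: one direction gives existence, the other uniqueness, since
    every element of Q_K has some such coefficients. No dimension count is made. *)

(** * Indices of the triangle's vertices, added modulo 3 *)

Lemma ord3_cyclic (i k : 'I_3) : [\/ k = i, k = i + 1 | k = i + 2%:R].
Proof.
suff : [|| k == i, k == i + 1 | k == i + 2%:R].
  by case/or3P => /eqP->; do ?[by constructor 1 | by constructor 2 | by constructor 3].
by case: i => [[|[|[|//]]] ?]; case: k => [[|[|[|//]]] ?].
Qed.

Lemma ord3_neq (i : 'I_3) :
  ((i == i + 1) = false) * ((i == i + 2%:R) = false) *
  ((i + 1 == i) = false) * ((i + 2%:R == i) = false) *
  ((i + 1 == i + 2%:R) = false) * ((i + 2%:R == i + 1) = false).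
Proof. by case: i => [[|[|[|//]]] ?]. Qed.

(** Starting the cycle at a distinguished vertex lets one computation serve all three. *)
Lemma big_ord3_cyclic (V : nmodType) (F : 'I_3 -> V) (i : 'I_3) :
  \sum_j F j = F i + F (i + 1) + F (i + 2%:R).
Proof.
rewrite (bigD1 i) //= (bigD1 (i + 1)) ?ord3_neq //= (bigD1 (i + 2%:R)) ?ord3_neq //=.
rewrite big1 => [|j]; first by rewrite addr0 addrA.
by case: (ord3_cyclic i j) => ->; rewrite eqxx ?ord3_neq ?andbF.
Qed.

Lemma ord3_add : ((0 + 1 = 1 :> 'I_3) * (0 + 2%:R = 2%:R :> 'I_3) *
  (1 + 1 = 2%:R :> 'I_3) * (1 + 2%:R = 0 :> 'I_3) *
  (2%:R + 1 = 0 :> 'I_3) * (2%:R + 2%:R = 1 :> 'I_3)).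
Proof. by do !split; apply: val_inj. Qed.

Lemma ord2P (m : 'I_2) : m = 0 \/ m = 1.
Proof. by case: m => [[|[|//]] ?]; [left | right]; apply: val_inj. Qed.

(** * Evaluation, directional derivatives and degree of polynomials *)

Section Polynomials.
Context {R : realType}.
Implicit Types (p q l : {mpoly R[3]}) (w x : 'rV[R]_3).

Lemma pevalD p q x : peval (p + q) x = peval p x + peval q x.
Proof. exact: mevalD. Qed.

Lemma pevalN p x : peval (- p) x = - peval p x.
Proof. exact: mevalN. Qed.

Lemma pevalM p q x : peval (p * q) x = peval p x * peval q x.
Proof. exact: mevalM. Qed.

Lemma pevalC c x : peval c%:MP x = c.
Proof. exact: mevalC. Qed.

Lemma peval1 x : peval 1 x = 1.
Proof. exact: meval1. Qed.

Lemma pevalX i x : peval 'X_i x = x ord0 i.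
Proof. exact: mevalXU. Qed.

Lemma peval_sum (I : finType) (F : I -> {mpoly R[3]}) x :
  peval (\sum_j F j) x = \sum_j peval (F j) x.
Proof. exact: raddf_sum. Qed.

Lemma normal_derivD p q w x :
  normal_deriv (p + q) w x = normal_deriv p w x + normal_deriv q w x.
Proof.
rewrite -big_split; apply: eq_bigr => k _.
by rewrite mderivD pevalD mulrDr.
Qed.

Lemma normal_derivM p q w x :
  normal_deriv (p * q) w x =
  normal_deriv p w x * peval q x + peval p x * normal_deriv q w x.
Proof.
rewrite mulr_suml mulr_sumr -big_split; apply: eq_bigr => k _ /=.
by rewrite mderivM pevalD !pevalM; ring.
Qed.

Lemma normal_derivC c w x : normal_deriv c%:MP w x = 0.
Proof.
by rewrite /normal_deriv big1 // => k _; rewrite mderivC /peval meval0 mulr0.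
Qed.

Lemma normal_derivN p w x : normal_deriv (- p) w x = - normal_deriv p w x.
Proof.
rewrite -mulN1r -mpolyC1 -mpolyCN normal_derivM normal_derivC pevalC.
by rewrite mul0r add0r mulN1r.
Qed.

Lemma normal_derivX i w x : normal_deriv 'X_i w x = w ord0 i.
Proof.
rewrite /normal_deriv (bigD1 i) //= big1 => [|k ki].
  rewrite mderivX mnm1E eqxx -{1}[U_(i)%MM]add0m addmK mpolyX0.
  by rewrite scale1r peval1 mulr1 addr0.
by rewrite mderivX mnm1E eq_sym (negPf ki) scale0r /peval meval0 mulr0.
Qed.

Lemma normal_deriv_sum (I : finType) (F : I -> {mpoly R[3]}) w x :
  normal_deriv (\sum_j F j) w x = \sum_j normal_deriv (F j) w x.
Proof.
apply: (big_morph (fun p => normal_deriv p w x)) => [p q|].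
  exact: normal_derivD.
by rewrite -mpolyC0 normal_derivC.
Qed.

Lemma in_PD k p q : in_P k p -> in_P k q -> in_P k (p + q).
Proof.
by move=> pk qk; apply: leq_trans (msizeD_le _ _) _; rewrite geq_max; apply/andP.
Qed.

Lemma in_PC k (c : R) : in_P k (c%:MP : {mpoly R[3]}).
Proof. by rewrite /in_P mmeasureC; case: (c != 0). Qed.

Lemma in_PX i : in_P 1 ('X_i : {mpoly R[3]}).
Proof. by rewrite /in_P msizeX mdeg1. Qed.

Lemma in_PM j k p q : in_P j p -> in_P k q -> in_P (j + k) (p * q).
Proof.
rewrite /in_P => pj qk.
have [->|p0] := eqVneq p 0; first by rewrite mul0r mmeasure0.
have [->|q0] := eqVneq q 0; first by rewrite mulr0 mmeasure0.
by rewrite msizeM // -subn1 leq_subLR add1n -addnS -addSn leq_add.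
Qed.

Lemma in_PMC k (c : R) p : in_P k p -> in_P k (c%:MP * p).
Proof. exact: (@in_PM 0 k _ _ (in_PC 0 c)). Qed.

Lemma in_P_sum k (I : finType) (F : I -> {mpoly R[3]}) :
  (forall j, in_P k (F j)) -> in_P k (\sum_j F j).
Proof.
move=> FP; apply: (big_ind (in_P k)) => // [|p q]; last exact: in_PD.
by rewrite /in_P mmeasure0.
Qed.

Lemma in_P_ind k (P : {mpoly R[3]} -> Prop) :
    P 0 -> (forall p q, P p -> P q -> P (p + q)) ->
    (forall c p, P p -> P (c%:MP * p)) ->
    (forall m : 'X_{1..3}, (mdeg m <= k)%N -> P 'X_[m]) ->
  forall p, in_P k p -> P p.
Proof.
move=> P0 PD PZ PX p pk; rewrite [p]mpolyE big_seq.
apply: (big_ind P) => // m /msize_mdeg_lt mp; rewrite -mul_mpolyC.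
by apply/PZ/PX; rewrite -ltnS (leq_trans mp).
Qed.

Lemma monomial_factor k (m : 'X_{1..3}) : (mdeg m <= k.+1)%N ->
  mdeg m = 0%N \/
  exists i (m' : 'X_{1..3}), (mdeg m' <= k)%N /\ 'X_[R, m] = 'X_i * 'X_[m'].
Proof.
case: (boolP (m == 0%MM)) => [/eqP-> _|m0 mk]; first by left; rewrite mdeg0.
right; have [i mi] : exists i, m i != 0%N.
  apply/existsP; rewrite -negb_forall; apply: contra m0 => /forallP m_0.
  by apply/eqP/mnmP => i; rewrite mnm0E; apply/eqP.
have lm : (U_(i) <= m)%MM by rewrite lep1mP.
exists i, (m - U_(i))%MM; rewrite -mpolyXD addmC submK //; split=> //.
by move: mk; rewrite -{1}(submK lm) mdegD mdeg1 addn1.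
Qed.

Lemma in_P1_ind (P : {mpoly R[3]} -> Prop) :
    (forall p q, P p -> P q -> P (p + q)) ->
    (forall c p, P p -> P (c%:MP * p)) ->
    P 1 -> (forall i, P 'X_i) ->
  forall p, in_P 1 p -> P p.
Proof.
move=> PD PZ P1 PX; apply: in_P_ind => // [|m /(@monomial_factor 0)].
  by rewrite -(mul0r 1) -mpolyC0; apply: PZ.
case=> [/eqP|[i [m' []]]]; first by rewrite mdeg_eq0 => /eqP->; rewrite mpolyX0.
by rewrite leqn0 mdeg_eq0 => /eqP-> ->; rewrite mpolyX0 mulr1.
Qed.

(** A monomial of degree at most 2 is a product of two affine polynomials. Stating the base case for
    all such products leaves the choice of affine basis free. *)
Lemma in_P2_ind (P : {mpoly R[3]} -> Prop) :
    (forall p q, P p -> P q -> P (p + q)) ->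
    (forall c p, P p -> P (c%:MP * p)) ->
    (forall p q, in_P 1 p -> in_P 1 q -> P (p * q)) ->
  forall p, in_P 2 p -> P p.
Proof.
have P1 : in_P 1 (1 : {mpoly R[3]}) by rewrite -mpolyC1; apply: in_PC.
move=> PD PZ PM; apply: in_P_ind => // [|m /(@monomial_factor 1)].
  by rewrite -(mul0r 1) -mpolyC0; apply/PZ; rewrite -(mulr1 1); apply: PM.
case=> [/eqP|[i [m' [m'1 ->]]]].
  by rewrite mdeg_eq0 => /eqP->; rewrite mpolyX0 -(mulr1 1); apply: PM.
by apply: PM; [apply: in_PX | rewrite /in_P msizeX ltnS].
Qed.

(** Affine functions commute with means; this reduces values at face centroids to values at
    vertices. *)
Lemma peval_mean l (n : nat) (I : Type) (r : seq I) (F : I -> 'rV[R]_3) :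
    in_P 1 l -> size r = n.+1 ->
  peval l (n.+1%:R^-1 *: \sum_(j <- r) F j) =
  n.+1%:R^-1 * \sum_(j <- r) peval l (F j).
Proof.
move=> lP rn; move: l lP; apply: in_P1_ind => [p q Ep Eq|c p Ep||i].
- rewrite pevalD Ep Eq -mulrDr -big_split; congr (_ * _).
  by apply: eq_bigr => j _; rewrite pevalD.
- rewrite pevalM pevalC Ep mulrCA mulr_sumr; congr (_ * _).
  by apply: eq_bigr => j _; rewrite pevalM pevalC.
- rewrite peval1; under eq_bigr do rewrite peval1.
  rewrite big_const_seq count_predT iter_addr_0 rn -[1 *+ _]/(_%:R).
  by rewrite mulVf // pnatr_eq0.
- rewrite pevalX !mxE summxE; congr (_ * _).
  by apply: eq_bigr => j _; rewrite pevalX.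
Qed.

End Polynomials.

Section Prism.
Context {R : realType}.
Implicit Types (K : prism R) (l p v : {mpoly R[3]}) (w x : 'rV[R]_3).
Implicit Types (a b : 'rV[R]_2) (i j k : 'I_3).

(** * Barycentric and vertical coordinates of the prism *)

Definition hcoord (m : 'I_2) : 'I_3 := lshift 1 m.
Definition vcoord : 'I_3 := rshift 2 ord0.

Definition cross a b : R := a 0 0 * b 0 1 - a 0 1 * b 0 0.

Lemma row_free_cross a b : row_free (col_mx a b) -> cross a b != 0.
Proof.
move=> free; have indep (s t : R) : s *: a + t *: b = 0 -> s = 0 /\ t = 0.
  move=> st0; have /(row_free_inj free)/eqP :
    row_mx s%:M t%:M *m col_mx a b = 0 *m col_mx a b.
    by rewrite mul0mx mul_row_col !mul_scalar_mx.
  rewrite row_mx_eq0 => /andP[/eqP/matrixP/(_ 0 0) s0 /eqP/matrixP/(_ 0 0) t0].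
  by move: s0 t0; rewrite !mxE !mulr1n.
apply/eqP => ab0.
(* With zero determinant, b_m a - a_m b = 0 for m = 0, 1. Independence kills every entry of a and b,
   and then 1 a + 0 b = 0 is a contradiction. *)
have [b00 /oppr_inj a00] : b 0 0 = 0 /\ - a 0 0 = - 0.
  rewrite oppr0; apply: indep; apply/rowP => m; rewrite !mxE.
  by case: (ord2P m) => ->; move: ab0; rewrite /cross; lra.
have [b01 /oppr_inj a01] : b 0 1 = 0 /\ - a 0 1 = - 0.
  rewrite oppr0; apply: indep; apply/rowP => m; rewrite !mxE.
  by case: (ord2P m) => ->; move: ab0; rewrite /cross; lra.
case: (indep 1 0) => [|/eqP]; last by rewrite oner_eq0.
apply/rowP => m; rewrite !mxE.
by case: (ord2P m) => ->; rewrite ?(a00, a01, b00, b01) !mulr0 addr0.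
Qed.

(** Twice the signed area of the base; its sign depends on the orientation of the vertices. *)
Definition area K := cross (base K 1 - base K 0) (base K 2%:R - base K 0).

Lemma area_neq0 K : area K != 0.
Proof.
have e0 : inord 0 = 0 :> 'I_3 by apply: val_inj; rewrite /= inordK.
have e1 : inord 1 = 1 :> 'I_3 by apply: val_inj; rewrite /= inordK.
have e2 : inord 2 = 2%:R :> 'I_3 by apply: val_inj; rewrite /= inordK.
by apply: row_free_cross; have := base_nondegenerate K; rewrite e0 e1 e2.
Qed.

Lemma area_cyclic K i :
  area K = cross (base K (i + 1) - base K i) (base K (i + 2%:R) - base K i).
Proof.
rewrite /area /cross; case: (ord3_cyclic 0 i) => ->; rewrite !(ord3_add, mxE) //.
  by ring.
by ring.
Qed.

Definition height K := ztop K - zbot K.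

Lemma height_neq0 K : height K != 0.
Proof. by rewrite subr_eq0 gt_eqF // zbot_lt_ztop. Qed.

(* The barycentric coordinate of the vertex j: up to the factor [area K], the *)
(* cross product of the vectors from x to the two other vertices.             *)
Definition bary K j : {mpoly R[3]} :=
  let a := base K (j + 1) in let b := base K (j + 2%:R) in
  (cross a b / area K)%:MP + ((a 0 1 - b 0 1) / area K)%:MP * 'X_(hcoord 0)
  + ((b 0 0 - a 0 0) / area K)%:MP * 'X_(hcoord 1).

(** The gradient of [bary K j] paired with [w], a constant because [bary K j] is affine. *)
Definition slope K j w : R :=
  let a := base K (j + 1) in let b := base K (j + 2%:R) in
  ((a 0 1 - b 0 1) * w 0 (hcoord 0) + (b 0 0 - a 0 0) * w 0 (hcoord 1)) / area K.

(* The affine function of x3 equal to -1 on the bottom face and 1 on the top. *)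
Definition vert K : {mpoly R[3]} :=
  (- (ztop K + zbot K) / height K)%:MP + (2 / height K)%:MP * 'X_vcoord.

Lemma in_P_bary K j : in_P 1 (bary K j).
Proof.
by do !apply: in_PD; [apply: in_PC | apply: in_PMC (in_PX _)..].
Qed.

Lemma in_P_vert K : in_P 1 (vert K).
Proof. by apply: in_PD; [apply: in_PC | apply: in_PMC (in_PX _)]. Qed.

Lemma point3_hcoord a z m : point3 a z 0 (hcoord m) = a 0 m.
Proof. exact: row_mxEl. Qed.

Lemma point3_vcoord a z : point3 a z 0 vcoord = z.
Proof. by rewrite [LHS]row_mxEr mxE eqxx. Qed.

Lemma bary_point3 K j k z : peval (bary K j) (point3 (base K k) z) = (j == k)%:R.
Proof.
rewrite /bary !(pevalD, pevalM, pevalC, pevalX) !point3_hcoord /cross.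
have D0 := area_neq0 K; have := area_cyclic K j; rewrite /cross !mxE => D.
case: (ord3_cyclic j k) => ->; rewrite ?eqxx ?ord3_neq /=; last 2 first.
- by field.
- by field.
by apply/(mulIf D0); rewrite mul1r [RHS]D; field.
Qed.

Lemma vert_point3 K a z :
  peval (vert K) (point3 a z) = (2 * z - ztop K - zbot K) / height K.
Proof.
rewrite /vert !(pevalD, pevalM, pevalC, pevalX) point3_vcoord.
by have := height_neq0 K; move=> ?; field.
Qed.

Lemma normal_deriv_bary K j w x : normal_deriv (bary K j) w x = slope K j w.
Proof.
rewrite /bary !(normal_derivD, normal_derivM, normal_derivC, normal_derivX, pevalC).
by rewrite /slope; ring.
Qed.

Lemma normal_deriv_vert K w x : normal_deriv (vert K) w x = 2 / height K * w 0 vcoord.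
Proof.
rewrite /vert !(normal_derivD, normal_derivM, normal_derivC, normal_derivX, pevalC).
by ring.
Qed.

(** Comparison of coefficients, with the denominator [area K] cleared so that the hypotheses are
    polynomial identities for [ring]. *)
Lemma bary_comb K (u : 'I_3 -> R) (c c0 c1 : R) :
    \sum_j u j * cross (base K (j + 1)) (base K (j + 2%:R)) = c * area K ->
    \sum_j u j * (base K (j + 1) 0 1 - base K (j + 2%:R) 0 1) = c0 * area K ->
    \sum_j u j * (base K (j + 2%:R) 0 0 - base K (j + 1) 0 0) = c1 * area K ->
  \sum_j (u j)%:MP * bary K j =
  c%:MP + c0%:MP * 'X_(hcoord 0) + c1%:MP * 'X_(hcoord 1).
Proof.
move=> Ec E0 E1; have D0 := area_neq0 K.
rewrite -[c](mulfK D0) -[c0](mulfK D0) -[c1](mulfK D0) -Ec -E0 -E1.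
by rewrite !(big_ord3_cyclic _ 0) /bary; ring.
Qed.

Lemma bary_sum1 K : \sum_j bary K j = 1.
Proof.
transitivity (\sum_j (1 : R)%:MP * bary K j).
  by apply: eq_bigr => j _; rewrite mpolyC1 mul1r.
rewrite (@bary_comb K _ 1 0 0) ?mpolyC0 ?mpolyC1 ?mul0r ?addr0 //.
all: rewrite !(big_ord3_cyclic _ 0) !ord3_add /area /cross ?mxE; ring.
Qed.

Lemma bary_coord K m : \sum_j (base K j 0 m)%:MP * bary K j = 'X_(hcoord m).
Proof.
rewrite (@bary_comb K _ 0 (m == 0)%:R (m == 1)%:R).
  by case: (ord2P m) => ->; rewrite /= !(mpolyC0, mpolyC1, mul0r, mul1r, addr0, add0r).
all: rewrite !(big_ord3_cyclic _ 0) !ord3_add /area /cross ?mxE.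
all: by case: (ord2P m) => -> /=; ring.
Qed.

(** * The eleven-parameter family and its quadratic members *)

(** The [g] terms and the cubic vanish at all six vertices, so vertex values involve only [b], [d]
    and [e]. *)
Definition prism_poly K (b g d : 'I_3 -> R) (e c : R) : {mpoly R[3]} :=
  \sum_j (b j)%:MP * bary K j + \sum_j (g j)%:MP * (bary K j * (1 - bary K j))
  + vert K * \sum_j (d j)%:MP * bary K j + e%:MP * (vert K * vert K)
  + c%:MP * (vert K * (vert K + 1) * (vert K - 1)).

Definition is_prism_quadratic K v : Prop :=
  exists (b g d : 'I_3 -> R) (e : R), v = prism_poly K b g d e 0.

Lemma sum_mpolyCD (u u' : 'I_3 -> R) (F : 'I_3 -> {mpoly R[3]}) :
  \sum_j (u j + u' j)%:MP * F j = \sum_j (u j)%:MP * F j + \sum_j (u' j)%:MP * F j.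
Proof. by rewrite -big_split; apply: eq_bigr => j _; rewrite mpolyCD mulrDl. Qed.

Lemma sum_mpolyCM c (u : 'I_3 -> R) (F : 'I_3 -> {mpoly R[3]}) :
  \sum_j (c * u j)%:MP * F j = c%:MP * \sum_j (u j)%:MP * F j.
Proof. by rewrite mulr_sumr; apply: eq_bigr => j _; rewrite mpolyCM mulrA. Qed.

Lemma sum_mpolyC_delta i (F : 'I_3 -> {mpoly R[3]}) :
  \sum_j ((j == i)%:R : R)%:MP * F j = F i.
Proof.
rewrite (bigD1 i) //= eqxx mpolyC1 mul1r big1 ?addr0 // => j /negPf->.
by rewrite mpolyC0 mul0r.
Qed.

Lemma sum_mpolyC0 (F : 'I_3 -> {mpoly R[3]}) :
  \sum_j (0 : R)%:MP * F j = 0.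
Proof. by rewrite big1 // => j _; rewrite mpolyC0 mul0r. Qed.

Lemma prism_quadraticD K p v :
  is_prism_quadratic K p -> is_prism_quadratic K v -> is_prism_quadratic K (p + v).
Proof.
move=> [b [g [d [e ->]]]] [b' [g' [d' [e' ->]]]].
exists (fun j => b j + b' j), (fun j => g j + g' j), (fun j => d j + d' j), (e + e').
by rewrite /prism_poly !sum_mpolyCD; ring.
Qed.

Lemma prism_quadraticZ K c p :
  is_prism_quadratic K p -> is_prism_quadratic K (c%:MP * p).
Proof.
move=> [b [g [d [e ->]]]].
exists (fun j => c * b j), (fun j => c * g j), (fun j => c * d j), (c * e).
by rewrite /prism_poly !sum_mpolyCM; ring.
Qed.

Lemma prism_quadratic_bary K i : is_prism_quadratic K (bary K i).
Proof.
exists (fun j => (j == i)%:R), (fun=> 0), (fun=> 0), 0.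
by rewrite /prism_poly sum_mpolyC_delta !sum_mpolyC0; ring.
Qed.

Lemma prism_quadratic_bubble K i :
  is_prism_quadratic K (bary K i * (1 - bary K i)).
Proof.
exists (fun=> 0), (fun j => (j == i)%:R), (fun=> 0), 0.
by rewrite /prism_poly (sum_mpolyC_delta i) !sum_mpolyC0; ring.
Qed.

Lemma prism_quadratic_vert_bary K i : is_prism_quadratic K (vert K * bary K i).
Proof.
exists (fun=> 0), (fun=> 0), (fun j => (j == i)%:R), 0.
by rewrite /prism_poly sum_mpolyC_delta !sum_mpolyC0; ring.
Qed.

Lemma prism_quadratic_vert_vert K : is_prism_quadratic K (vert K * vert K).
Proof.
exists (fun=> 0), (fun=> 0), (fun=> 0), 1.
by rewrite /prism_poly !sum_mpolyC0; ring.
Qed.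

Lemma prism_quadratic_bary_bary K i j : is_prism_quadratic K (bary K i * bary K j).
Proof.
have neq k : is_prism_quadratic K (bary K k * bary K (k + 1)).
  (* With t, u and 1 - t - u the three coordinates, 2 t u is                 *)
  (* t (1 - t) + u (1 - u) - (1 - t - u) (t + u).                            *)
  have E : bary K (k + 2%:R) = 1 - bary K k - bary K (k + 1).
    by rewrite -(bary_sum1 K) (big_ord3_cyclic _ k); ring.
  have -> : bary K k * bary K (k + 1) = (2^-1)%:MP * (
      bary K k * (1 - bary K k) + bary K (k + 1) * (1 - bary K (k + 1))
      + (-1)%:MP * (bary K (k + 2%:R) * (1 - bary K (k + 2%:R)))).
    have /(congr1 (@mpolyC 3 R)) : 2^-1 * 2 = 1 :> R by rewrite mulVf ?pnatr_eq0.
    by rewrite mpolyCM mpolyC1 E => h2; ring: h2.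
  apply/prism_quadraticZ/prism_quadraticD; last first.
    exact/prism_quadraticZ/prism_quadratic_bubble.
  by apply: prism_quadraticD; apply: prism_quadratic_bubble.
case: (ord3_cyclic i j) => ->; last 2 first.
- exact: neq.
(* The pair (i + 2, i) is again consecutive modulo 3. *)
- rewrite mulrC; have := neq (i + 2%:R).
  by rewrite -[i + 2%:R + 1]addrA ord3_add addr0.
have -> : bary K i * bary K i
    = bary K i + (-1)%:MP * (bary K i * (1 - bary K i)) by ring.
apply: prism_quadraticD (prism_quadratic_bary K i) _.
exact/prism_quadraticZ/prism_quadratic_bubble.
Qed.

Lemma affine_barycentric K l : in_P 1 l ->
  exists (b : 'I_3 -> R) e, l = \sum_j (b j)%:MP * bary K j + e%:MP * vert K.
Proof.
move: l; apply: in_P1_ind => [p q [b [e ->]] [b' [e' ->]]|c p [b [e ->]]||k].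
- by exists (fun j => b j + b' j), (e + e'); rewrite sum_mpolyCD; ring.
- by exists (fun j => c * b j), (c * e); rewrite sum_mpolyCM; ring.
- exists (fun=> 1), 0; rewrite mpolyC0 mul0r addr0 -(bary_sum1 K).
  by apply: eq_bigr => j _; rewrite mpolyC1 mul1r.
rewrite -[k](@splitK 2 1); case: (@split 2 1 k) => m /=.
  by exists (fun j => base K j 0 m), 0; rewrite bary_coord mpolyC0 mul0r addr0.
(* Inverting [vert]: x_3 is the mid-height plus half the height times [vert K], the constant being
   spread over the coordinates, which sum to 1. *)
exists (fun=> (ztop K + zbot K) / 2), (height K / 2); rewrite ord1.
have h0 := height_neq0 K.
have e0 : (ztop K + zbot K) / 2 + height K / 2 * (- (ztop K + zbot K) / height K) = 0.
  by field.
have e1 : height K / 2 * (2 / height K) = 1 by field.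
rewrite -mulr_sumr bary_sum1 mulr1 /vert mulrDr !mulrA -!mpolyCM addrA -mpolyCD.
by rewrite e0 e1 mpolyC0 mpolyC1 add0r mul1r.
Qed.

(** Expanding both factors of a product of affine functions leaves only t_i t_j, s t_j and s^2, each
    already in the family. *)
Lemma in_P2_prism_quadratic K p : in_P 2 p -> is_prism_quadratic K p.
Proof.
have mul_affine l q : in_P 1 q -> (forall j, is_prism_quadratic K (l * bary K j)) ->
    is_prism_quadratic K (l * vert K) -> is_prism_quadratic K (l * q).
  move=> /(affine_barycentric K)[b [e ->]] lb lv.
  rewrite mulrDr mulr_sumr; apply: prism_quadraticD; last first.
    by rewrite mulrCA; apply: prism_quadraticZ.
  apply: (big_ind (is_prism_quadratic K)) => [||j _].
  - rewrite -(mul0r (vert K * vert K)) -mpolyC0.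
    exact/prism_quadraticZ/prism_quadratic_vert_vert.
  - exact: prism_quadraticD.
  - by rewrite mulrCA; apply: prism_quadraticZ.
apply: in_P2_ind => [q v|c q|q v qP vP].
- exact: prism_quadraticD.
- exact: prism_quadraticZ.
apply: (mul_affine) => // [j|]; rewrite mulrC; apply: (mul_affine) => // [i|].
- exact: prism_quadratic_bary_bary.
- by rewrite mulrC; apply: prism_quadratic_vert_bary.
- exact: prism_quadratic_vert_bary.
- exact: prism_quadratic_vert_vert.
Qed.

Lemma prism_poly_cubic K (b g d : 'I_3 -> R) (e c : R) :
  prism_poly K b g d e c =
  prism_poly K b g d e 0 + c%:MP * (vert K * (vert K + 1) * (vert K - 1)).
Proof. by rewrite /prism_poly; ring. Qed.

Lemma in_P_prism_poly K (b g d : 'I_3 -> R) (e : R) : in_P 2 (prism_poly K b g d e 0).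
Proof.
have leP p : in_P 1 p -> in_P 2 p by rewrite /in_P => /leq_trans; apply.
have bP (u : 'I_3 -> R) : in_P 1 (\sum_j (u j)%:MP * bary K j).
  by apply: in_P_sum => j; apply/in_PMC/in_P_bary.
rewrite /prism_poly mpolyC0 mul0r addr0; do !apply: in_PD.
- exact: leP.
- apply: in_P_sum => j; apply: in_PMC; apply: (@in_PM _ 1 1); first exact: in_P_bary.
  have -> : 1 - bary K j = 1%:MP + (-1)%:MP * bary K j by ring.
  by apply: in_PD; [apply: in_PC | apply/in_PMC/in_P_bary].
- by apply: (@in_PM _ 1 1) => //; apply: in_P_vert.
- by apply: in_PMC; apply: (@in_PM _ 1 1); apply: in_P_vert.
Qed.

(** * Values of the coordinates at vertices and face centroids *)

Lemma vertex_bottom K j : vertex K (lshift 3 j) = point3 (base K j) (zbot K).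
Proof. by rewrite /vertex (unsplitK (inl j)). Qed.

Lemma vertex_top K j : vertex K (rshift 3 j) = point3 (base K j) (ztop K).
Proof. by rewrite /vertex (unsplitK (inr j)). Qed.

(** Side face k lies over the edge opposite to base vertex k, hence this cyclic description. *)
Lemma face_side k :
  face (lshift 2 k) =
  [:: lshift 3 (k + 1); lshift 3 (k + 2%:R); rshift 3 (k + 2%:R); rshift 3 (k + 1)].
Proof.
by case: k => [[|[|[|//]]] ?]; congr [:: _; _; _; _]; apply: val_inj; rewrite /= inordK.
Qed.

Lemma face_bottom :
  face (rshift 3 0) =
  [:: lshift 3 (0 : 'I_3); lshift 3 (1 : 'I_3); lshift 3 (2%:R : 'I_3)].
Proof. by congr [:: _; _; _]; apply: val_inj; rewrite /= inordK. Qed.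

Lemma face_top :
  face (rshift 3 1) =
  [:: rshift 3 (0 : 'I_3); rshift 3 (1 : 'I_3); rshift 3 (2%:R : 'I_3)].
Proof. by congr [:: _; _; _]; apply: val_inj; rewrite /= inordK. Qed.

Lemma bary_vertex_bottom K j k : peval (bary K j) (vertex K (lshift 3 k)) = (j == k)%:R.
Proof. by rewrite vertex_bottom bary_point3. Qed.

Lemma bary_vertex_top K j k : peval (bary K j) (vertex K (rshift 3 k)) = (j == k)%:R.
Proof. by rewrite vertex_top bary_point3. Qed.

Lemma vert_vertex_bottom K k : peval (vert K) (vertex K (lshift 3 k)) = -1.
Proof.
have h0 := height_neq0 K; rewrite vertex_bottom vert_point3.
by apply/(mulIf h0); rewrite mulfVK // /height; ring.
Qed.

Lemma vert_vertex_top K k : peval (vert K) (vertex K (rshift 3 k)) = 1.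
Proof.
have h0 := height_neq0 K; rewrite vertex_top vert_point3.
by apply/(mulIf h0); rewrite mulfVK // /height; ring.
Qed.

Definition vertex_values := (bary_vertex_bottom, bary_vertex_top,
  vert_vertex_bottom, vert_vertex_top).

Lemma bary_side K j k :
  peval (bary K j) (face_centroid K (lshift 2 k)) = (j != k)%:R / 2.
Proof.
rewrite /face_centroid face_side (peval_mean _ (in_P_bary K j)) //.
rewrite !big_cons big_nil !vertex_values.
by case: (ord3_cyclic k j) => ->; rewrite ?eqxx !ord3_neq /=; field.
Qed.

Lemma vert_side K k : peval (vert K) (face_centroid K (lshift 2 k)) = 0.
Proof.
rewrite /face_centroid face_side (peval_mean _ (in_P_vert K)) //.
by rewrite !big_cons big_nil !vertex_values; field.
Qed.

Lemma bary_bottom K j : peval (bary K j) (face_centroid K (rshift 3 0)) = 3%:R^-1.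
Proof.
rewrite /face_centroid face_bottom (peval_mean _ (in_P_bary K j)) //.
rewrite !big_cons big_nil !vertex_values.
by case: (ord3_cyclic 0 j) => ->; rewrite ?ord3_add /=; field.
Qed.

Lemma bary_top K j : peval (bary K j) (face_centroid K (rshift 3 1)) = 3%:R^-1.
Proof.
rewrite /face_centroid face_top (peval_mean _ (in_P_bary K j)) //.
rewrite !big_cons big_nil !vertex_values.
by case: (ord3_cyclic 0 j) => ->; rewrite ?ord3_add /=; field.
Qed.

Lemma vert_bottom K : peval (vert K) (face_centroid K (rshift 3 0)) = -1.
Proof.
rewrite /face_centroid face_bottom (peval_mean _ (in_P_vert K)) //.
by rewrite !big_cons big_nil !vertex_values; field.
Qed.

Lemma vert_top K : peval (vert K) (face_centroid K (rshift 3 1)) = 1.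
Proof.
rewrite /face_centroid face_top (peval_mean _ (in_P_vert K)) //.
by rewrite !big_cons big_nil !vertex_values; field.
Qed.

Definition centroid_values := (bary_side, vert_side, bary_bottom, bary_top,
  vert_bottom, vert_top).

(** * Normals of the faces *)

Lemma dotE w x :
  dot w x = w 0 (hcoord 0) * x 0 (hcoord 0) + w 0 (hcoord 1) * x 0 (hcoord 1)
            + w 0 vcoord * x 0 vcoord.
Proof.
have -> : hcoord 0 = 0 by apply: val_inj.
have -> : hcoord 1 = 1 by apply: val_inj.
have -> : vcoord = 2%:R by apply: val_inj.
by rewrite /dot (big_ord3_cyclic _ 0) !ord3_add.
Qed.

Lemma dot_point3 w a b (y z : R) :
  dot w (point3 a y - point3 b z) =
  w 0 (hcoord 0) * (a 0 0 - b 0 0) + w 0 (hcoord 1) * (a 0 1 - b 0 1)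
  + w 0 vcoord * (y - z).
Proof.
have pB k : (point3 a y - point3 b z) 0 k = point3 a y 0 k - point3 b z 0 k.
  by rewrite !mxE.
by rewrite dotE !pB !point3_hcoord !point3_vcoord.
Qed.

(** Orthogonality to a vertical edge makes [w] horizontal. Up to [area K], the slope pairs [w] with
    the rotated opposite edge; a unit horizontal vector orthogonal to that edge cannot be orthogonal
    to its rotation too. *)
Lemma side_normal K k w : unit_outward_normal K (lshift 2 k) w ->
  w 0 vcoord = 0 /\ slope K k w != 0.
Proof.
case=> perp w1 _; rewrite face_side in perp.
have := perp (lshift 3 (k + 1)) (rshift 3 (k + 1)).
have := perp (lshift 3 (k + 1)) (lshift 3 (k + 2%:R)).
rewrite !inE !eqxx !orbT !vertex_bottom vertex_top !dot_point3.
move=> /(_ isT isT) + /(_ isT isT); rewrite !subrr !mulr0 !add0r addr0 => e1 /eqP.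
rewrite -(opprB (ztop K)) mulf_eq0 oppr_eq0 (negPf (height_neq0 K)) orbF.
move=> /eqP wv; split=> //.
have ar0 := area_neq0 K; have := ar0; apply: contraNneq => s0; apply/eqP.
(* The goal is now [area K = 0]; since |w|^2 = 1, the area may be multiplied by |w|^2. *)
rewrite -[area K]mulr1 -w1 dotE wv mulr0 addr0 (area_cyclic _ k) /cross !mxE.
move: s0; rewrite /slope => /(canRL (mulfVK ar0)); rewrite mul0r => e2.
(* With e the edge opposite to the vertex k and e' its rotation by a right    *)
(* angle, w is orthogonal to both, and |w|^2 e combines w . e and w . e'.     *)
pose p m := base K (k + 1) 0 m - base K k 0 m.
(* The inner zeros are placeholders: the first and third become the left side of [e1], the others
   that of [e2], and [ring] checks the result. *)
transitivity
  (p 1 * (w 0 (hcoord 0) * 0 - w 0 (hcoord 1) * 0)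
   - p 0 * (w 0 (hcoord 1) * 0 + w 0 (hcoord 0) * 0)); last by ring.
by rewrite -{1 3}e1 -e2 /p; ring.
Qed.

Lemma horizontal_orthogonal K w :
    dot w w = 1 ->
    (forall j, w 0 (hcoord 0) * (base K j 0 0 - base K 0 0 0)
               + w 0 (hcoord 1) * (base K j 0 1 - base K 0 0 1) = 0) ->
  (forall j, slope K j w = 0) /\ w 0 vcoord != 0.
Proof.
move=> w1 e; have ar0 := area_neq0 K.
(* Cramer's rule for the two edges at base vertex 0, with determinant [area K]; the explicit zeros
   are again replaced by the left sides of [e]. *)
have w_0 : w 0 (hcoord 0) = 0.
  apply/(mulIf ar0); rewrite /area /cross !mxE.
  transitivity (0 * (base K 2%:R 0 1 - base K 0 0 1) - 0 * (base K 1 0 1 - base K 0 0 1)).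
    by rewrite -{1}(e 1) -(e 2%:R); ring.
  by ring.
have w_1 : w 0 (hcoord 1) = 0.
  apply/(mulIf ar0); rewrite /area /cross !mxE.
  transitivity (0 * (base K 1 0 0 - base K 0 0 0) - 0 * (base K 2%:R 0 0 - base K 0 0 0)).
    by rewrite -{1}(e 2%:R) -(e 1); ring.
  by ring.
split=> [j|]; first by rewrite /slope w_0 w_1 !mulr0 addr0 mul0r.
apply/eqP => w_2; move: w1; rewrite dotE w_0 w_1 w_2 !mulr0 !addr0 => /eqP.
by rewrite eq_sym oner_eq0.
Qed.

Lemma bottom_normal K w : unit_outward_normal K (rshift 3 0) w ->
  (forall j, slope K j w = 0) /\ w 0 vcoord != 0.
Proof.
case=> perp w1 _; rewrite face_bottom in perp; apply: horizontal_orthogonal => // j.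
have := perp (lshift 3 j) (lshift 3 (0 : 'I_3)); rewrite !vertex_bottom dot_point3.
rewrite subrr mulr0 addr0; apply; rewrite !inE ?eqxx //.
by case: (ord3_cyclic 0 j) => ->; rewrite ?ord3_add eqxx ?orbT.
Qed.

Lemma top_normal K w : unit_outward_normal K (rshift 3 1) w ->
  (forall j, slope K j w = 0) /\ w 0 vcoord != 0.
Proof.
case=> perp w1 _; rewrite face_top in perp; apply: horizontal_orthogonal => // j.
have := perp (rshift 3 j) (rshift 3 0); rewrite !vertex_top dot_point3.
rewrite subrr mulr0 addr0; apply; rewrite !inE ?eqxx //.
by case: (ord3_cyclic 0 j) => ->; rewrite ?ord3_add eqxx ?orbT.
Qed.

(** * Identification of the three lambda functions *)

Lemma in_plane_corners (a b c : 'rV[R]_3) :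
  [/\ in_plane a b c a, in_plane a b c b & in_plane a b c c].
Proof.
split; [exists 0, 0 | exists 1, 0 | exists 0, 1].
all: by rewrite ?scale0r ?scale1r ?addr0 // addrC subrK.
Qed.

Lemma peval_barycentric K (b : 'I_3 -> R) e x :
  peval (\sum_j (b j)%:MP * bary K j + e%:MP * vert K) x =
  \sum_j b j * peval (bary K j) x + e * peval (vert K) x.
Proof.
rewrite pevalD peval_sum pevalM pevalC; congr (_ + _).
by apply: eq_bigr => j _; rewrite pevalM pevalC.
Qed.

Lemma inord_side (k : 'I_3) : inord k = lshift 2 k :> 'I_5.
Proof. by apply: val_inj; rewrite /= inordK // (leq_trans (ltn_ord k)). Qed.

Lemma inord_bottom (k : 'I_3) : inord k = lshift 3 k :> 'I_6.
Proof. by apply: val_inj; rewrite /= inordK // (leq_trans (ltn_ord k)). Qed.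

Lemma inord_top (k : 'I_3) : inord (3 + k) = rshift 3 k :> 'I_6.
Proof. by apply: val_inj; rewrite /= inordK // -[6%N]/(3 + 3)%N ltn_add2l. Qed.

(** Vanishing at the side centroids makes the [b] coefficients sum to zero in pairs, so all are
    zero; the value at V_4 then gives e = 1. *)
Lemma lambda0E K l : is_lambda0 K l -> l = vert K.
Proof.
case=> lP + + _; have [b [e ->]] := affine_barycentric K lP.
rewrite (inord_side 0) (inord_side 1) (inord_side 2%:R) (inord_top 0).
move=> z0; rewrite peval_barycentric.
have [/z0 + /z0 + /z0] := in_plane_corners (face_centroid K (lshift 2 (0 : 'I_3)))
  (face_centroid K (lshift 2 (1 : 'I_3))) (face_centroid K (lshift 2 (2%:R : 'I_3))).
rewrite !peval_barycentric !(big_ord3_cyclic _ 0) !ord3_add.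
rewrite !(centroid_values, vertex_values) /=.
move=> e0 e1 e2 e3.
have [b0 b1 b2] : [/\ b 0 = 0, b 1 = 0 & b 2%:R = 0] by split; lra.
have -> : e = 1 by lra.
by rewrite b0 b1 b2 mpolyC0 mpolyC1; ring.
Qed.

(** The bottom vertices give b_j = e, and the value at M_1, where [vert] vanishes, gives e = 1. *)
Lemma lambda4E K l : is_lambda4 K l -> l = vert K + 1.
Proof.
case=> lP; have [b [e ->]] := affine_barycentric K lP.
rewrite (inord_side 0) (inord_bottom 0) (inord_bottom 1) (inord_bottom 2%:R).
move=> z0; rewrite peval_barycentric.
have [/z0 + /z0 + /z0] := in_plane_corners (vertex K (lshift 3 (0 : 'I_3)))
  (vertex K (lshift 3 (1 : 'I_3))) (vertex K (lshift 3 (2%:R : 'I_3))).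
rewrite !peval_barycentric -(bary_sum1 K) !(big_ord3_cyclic _ 0) !ord3_add.
rewrite !(centroid_values, vertex_values) /=.
move=> e0 e1 e2 e3.
have [b0 b1 b2] : [/\ b 0 = 1, b 1 = 1 & b 2%:R = 1] by split; lra.
have -> : e = 1 by lra.
by rewrite b0 b1 b2 mpolyC1; ring.
Qed.

Lemma lambda5E K l : is_lambda5 K l -> l = vert K - 1.
Proof.
case=> lP; have [b [e ->]] := affine_barycentric K lP.
rewrite (inord_side 0) (inord_top 0) (inord_top 1) (inord_top 2%:R).
move=> z0; rewrite peval_barycentric.
have [/z0 + /z0 + /z0] := in_plane_corners (vertex K (rshift 3 0))
  (vertex K (rshift 3 1)) (vertex K (rshift 3 2%:R)).
rewrite !peval_barycentric -(bary_sum1 K) !(big_ord3_cyclic _ 0) !ord3_add.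
rewrite !(centroid_values, vertex_values) /=.
move=> e0 e1 e2 e3.
have [b0 b1 b2] : [/\ b 0 = -1, b 1 = -1 & b 2%:R = -1] by split; lra.
have -> : e = 1 by lra.
by rewrite b0 b1 b2 mpolyCN mpolyC1; ring.
Qed.

(** * The functionals evaluated on the family *)

Lemma peval_prism_poly K (b g d : 'I_3 -> R) (e c : R) x :
  let t j := peval (bary K j) x in let s := peval (vert K) x in
  peval (prism_poly K b g d e c) x =
  \sum_j b j * t j + \sum_j g j * (t j * (1 - t j)) + s * \sum_j d j * t j
  + e * (s * s) + c * (s * (s + 1) * (s - 1)).
Proof.
rewrite /prism_poly; move: (vert K) => S.
rewrite !(pevalN, pevalD, pevalM, pevalC, peval1, peval_sum).
have pevalE (u : 'I_3 -> R) (F : 'I_3 -> {mpoly R[3]}) :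
    \sum_j peval ((u j)%:MP * F j) x = \sum_j u j * peval (F j) x.
  by apply: eq_bigr => j _; rewrite pevalM pevalC.
rewrite !pevalE; congr (_ + _ + _ + _ + _).
by apply: eq_bigr => j _; rewrite !(pevalD, pevalN, peval1, pevalM).
Qed.

Lemma normal_deriv_prism_poly K (b g d : 'I_3 -> R) (e c : R) w x :
  let t j := peval (bary K j) x in let s := peval (vert K) x in
  let h := 2 / height K * w 0 vcoord in
  normal_deriv (prism_poly K b g d e c) w x =
  \sum_j b j * slope K j w + \sum_j g j * ((1 - 2 * t j) * slope K j w)
  + (h * (\sum_j d j * t j) + s * \sum_j d j * slope K j w)
  + e * (2 * s * h) + c * ((3%:R * s ^+ 2 - 1) * h).
Proof.
(* Folding h back into the derivative of [vert K] and abstracting [vert K] keeps it atomic under the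
   sum and product rules. *)
rewrite /prism_poly -mpolyC1 -(normal_deriv_vert K w x); move: (vert K) => S.
rewrite !(normal_derivN, normal_derivD, normal_derivM, normal_derivC, normal_deriv_sum).
rewrite !(pevalN, pevalD, pevalM, pevalC, peval_sum).
have -> : \sum_j normal_deriv ((b j)%:MP * bary K j) w x = \sum_j b j * slope K j w.
  apply: eq_bigr => j _.
  by rewrite normal_derivM normal_derivC normal_deriv_bary pevalC mul0r add0r.
have -> : \sum_j normal_deriv ((d j)%:MP * bary K j) w x = \sum_j d j * slope K j w.
  apply: eq_bigr => j _.
  by rewrite normal_derivM normal_derivC normal_deriv_bary pevalC mul0r add0r.
have -> : \sum_j normal_deriv ((g j)%:MP * (bary K j * (1%:MP - bary K j))) w x =
    \sum_j g j * ((1 - 2 * peval (bary K j) x) * slope K j w).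
  apply: eq_bigr => j _.
  rewrite !(normal_derivD, normal_derivM, normal_derivN, normal_derivC, normal_deriv_bary).
  by rewrite !(pevalD, pevalM, pevalN, pevalC) ; ring.
have -> : \sum_j peval ((d j)%:MP * bary K j) x = \sum_j d j * peval (bary K j) x.
  by apply: eq_bigr => j _; rewrite pevalM pevalC.
by ring.
Qed.

Section Functionals.
Context (K : prism R) (n : 'I_5 -> 'rV[R]_3).
Context (n_normal : forall m, unit_outward_normal K m (n m)).
Context (b g d : 'I_3 -> R) (e c : R).
Let v := prism_poly K b g d e c.

Lemma tau_bottom_vertex k : tau K n (lshift 5 (lshift 3 k)) v = b k - d k + e.
Proof.
rewrite /tau (unsplitK (inl (lshift 3 k))) /v peval_prism_poly !(big_ord3_cyclic _ k).
by rewrite !vertex_values ?eqxx !ord3_neq /=; ring.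
Qed.

Lemma tau_top_vertex k : tau K n (lshift 5 (rshift 3 k)) v = b k + d k + e.
Proof.
rewrite /tau (unsplitK (inl (rshift 3 k))) /v peval_prism_poly !(big_ord3_cyclic _ k).
by rewrite !vertex_values ?eqxx !ord3_neq /=; ring.
Qed.

(** At M_k, 1 - 2 t_j vanishes for j != k and is 1 for j = k; [vert] is 0 there and the normal is
    horizontal, so [d], [e] and [c] drop out. *)
Lemma tau_side k : tau K n (rshift 6 (lshift 2 k)) v =
  \sum_j b j * slope K j (n (lshift 2 k)) + g k * slope K k (n (lshift 2 k)).
Proof.
have [n0 _] := side_normal (n_normal (lshift 2 k)).
rewrite /tau (unsplitK (inr (lshift 2 k))) /v normal_deriv_prism_poly n0.
rewrite !(big_ord3_cyclic _ k) !centroid_values ?eqxx !ord3_neq /=.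
by field; exact: height_neq0.
Qed.

(** A vertical normal has zero slopes, leaving the s-derivative at t_j = 1/3, s = -1. *)
Lemma tau_bottom : tau K n (rshift 6 (rshift 3 0)) v =
  2 / height K * n (rshift 3 0) 0 vcoord * ((\sum_j d j) / 3%:R - 2 * e + 2 * c).
Proof.
have [s0 _] := bottom_normal (n_normal (rshift 3 0)).
rewrite /tau (unsplitK (inr (rshift 3 0))) /v normal_deriv_prism_poly.
rewrite !(big_ord3_cyclic _ 0) !s0 !centroid_values.
by field; exact: height_neq0.
Qed.

Lemma tau_top : tau K n (rshift 6 (rshift 3 1)) v =
  2 / height K * n (rshift 3 1) 0 vcoord * ((\sum_j d j) / 3%:R + 2 * e + 2 * c).
Proof.
have [s0 _] := top_normal (n_normal (rshift 3 1)).
rewrite /tau (unsplitK (inr (rshift 3 1))) /v normal_deriv_prism_poly.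
rewrite !(big_ord3_cyclic _ 0) !s0 !centroid_values.
by field; exact: height_neq0.
Qed.

End Functionals.

(** * Solution of the triangular system and unisolvence *)

Lemma forall_ord11 (P : 'I_11 -> Prop) :
  [/\ forall k : 'I_3, P (lshift 5 (lshift 3 k)),
      forall k : 'I_3, P (lshift 5 (rshift 3 k)),
      forall k : 'I_3, P (rshift 6 (lshift 2 k)),
      P (rshift 6 (rshift 3 0)) & P (rshift 6 (rshift 3 1))] ->
  forall m, P m.
Proof.
case=> P1 P2 P3 P4 P5 m.
rewrite -[m](@splitK 6 5); case: (@split 6 5 m) => {}m /=.
  by rewrite -[m](@splitK 3 3); case: (@split 3 3 m) => k /=.
rewrite -[m](@splitK 3 2); case: (@split 3 2 m) => k /=; first by [].
by case: (ord2P k) => ->.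
Qed.

Lemma prism_poly_unisolvent K (n : 'I_5 -> 'rV[R]_3) (alpha : 'I_11 -> R) :
    (forall m, unit_outward_normal K m (n m)) ->
  exists (b g d : 'I_3 -> R) (e c : R), forall (b' g' d' : 'I_3 -> R) (e' c' : R),
    (forall m, tau K n m (prism_poly K b' g' d' e' c') = alpha m) <->
    [/\ b' =1 b, g' =1 g, d' =1 d, e' = e & c' = c].
Proof.
move=> n_normal.
have [_ nb0] := bottom_normal (n_normal (rshift 3 0)).
have [_ nt0] := top_normal (n_normal (rshift 3 1)).
have sl0 k := (side_normal (n_normal (lshift 2 k))).2.
have h0 := height_neq0 K.
pose lo k := alpha (lshift 5 (lshift 3 k)).
pose hi k := alpha (lshift 5 (rshift 3 k)).
pose hb := 2 / height K * n (rshift 3 0) 0 vcoord.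
pose ht := 2 / height K * n (rshift 3 1) 0 vcoord.
have hb0 : hb != 0 by rewrite !mulf_neq0 ?invr_eq0 ?pnatr_eq0.
have ht0 : ht != 0 by rewrite !mulf_neq0 ?invr_eq0 ?pnatr_eq0.
pose d k := (hi k - lo k) / 2.
(* With D the sum of the d_j, the horizontal faces require D/3 - 2e + 2c = bot and D/3 + 2e + 2c =
   top; difference and sum yield [e] and [c]. *)
pose bot := alpha (rshift 6 (rshift 3 0)) / hb.
pose top := alpha (rshift 6 (rshift 3 1)) / ht.
pose e := (top - bot) / 4%:R.
pose c := (top + bot) / 4%:R - (\sum_j d j) / 6%:R.
pose b k := (hi k + lo k) / 2 - e.
pose g k := (alpha (rshift 6 (lshift 2 k))
  - \sum_j b j * slope K j (n (lshift 2 k))) / slope K k (n (lshift 2 k)).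
exists b, g, d, e, c => b' g' d' e' c'; split=> [tauE|[bE gE dE -> ->]].
  have dE k : d' k = d k.
    have := tauE (lshift 5 (lshift 3 k)); have := tauE (lshift 5 (rshift 3 k)).
    by rewrite tau_bottom_vertex // tau_top_vertex // /d /lo /hi; lra.
  have sE : \sum_j d' j = \sum_j d j by apply: eq_bigr.
  have := tauE (rshift 6 (rshift 3 0)); have := tauE (rshift 6 (rshift 3 1)).
  rewrite tau_bottom // tau_top // -/hb -/ht sE.
  rewrite mulrC => /(canRL (mulfK ht0)) Et; rewrite mulrC => /(canRL (mulfK hb0)) Eb.
  have eE : e' = e by rewrite /e /top /bot; lra.
  have cE : c' = c by rewrite /c /top /bot; lra.
  have bE k : b' k = b k.
    have := tauE (lshift 5 (lshift 3 k)); have := tauE (lshift 5 (rshift 3 k)).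
    by rewrite tau_bottom_vertex // tau_top_vertex // eE /b /lo /hi; lra.
  split=> // k; apply/(mulIf (sl0 k)); rewrite mulfVK //.
  have <- := tauE (rshift 6 (lshift 2 k)).
  rewrite tau_side //; under eq_bigr do rewrite bE.
  by rewrite [X in X - _]addrC addrK.
apply: forall_ord11; split=> [k|k|k||].
- by rewrite tau_bottom_vertex // bE dE /b /d /lo; field.
- by rewrite tau_top_vertex // bE dE /b /d /hi; field.
- rewrite tau_side // gE; under eq_bigr do rewrite bE.
  by rewrite mulfVK // addrC subrK.
- rewrite tau_bottom // -/hb; under eq_bigr do rewrite dE.
  by rewrite /c /e /top /bot; field; rewrite ?hb0 ?ht0.
- rewrite tau_top // -/ht; under eq_bigr do rewrite dE.
  by rewrite /c /e /top /bot; field; rewrite ?hb0 ?ht0.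
Qed.

Lemma eq_prism_poly K (b g d b' g' d' : 'I_3 -> R) (e c : R) :
    b =1 b' -> g =1 g' -> d =1 d' ->
  prism_poly K b g d e c = prism_poly K b' g' d' e c.
Proof.
move=> bE gE dE; rewrite /prism_poly; congr (_ + _ + _ * _ + _ + _).
all: by apply: eq_bigr => j _; rewrite ?(bE, gE, dE).
Qed.

Lemma in_Q_prism_poly K (l0 l4 l5 v : {mpoly R[3]}) :
    is_lambda0 K l0 -> is_lambda4 K l4 -> is_lambda5 K l5 ->
  in_Q l0 l4 l5 v <->
  exists (b g d : 'I_3 -> R) (e c : R), v = prism_poly K b g d e c.
Proof.
move=> /lambda0E-> /lambda4E-> /lambda5E->; split.
  case=> p [c [/(in_P2_prism_quadratic K)[b [g [d [e ->]]]] ->]].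
  by exists b, g, d, e, c; rewrite [RHS]prism_poly_cubic mul_mpolyC.
case=> b [g [d [e [c ->]]]]; exists (prism_poly K b g d e 0), c.
by rewrite [LHS]prism_poly_cubic mul_mpolyC; split=> //; apply: in_P_prism_poly.
Qed.

End Prism.

Theorem theorem3p2 (R : realType) (K : prism R)
    (n : 'I_5 -> 'rV[R]_3)
    (n_normal : forall i, unit_outward_normal K i (n i))
    (lambda0 lambda4 lambda5 : {mpoly R[3]})
    (lambda0P : is_lambda0 K lambda0)
    (lambda4P : is_lambda4 K lambda4)
    (lambda5P : is_lambda5 K lambda5)
    (alpha : 'I_11 -> R) :
  exists! v : {mpoly R[3]},
    in_Q lambda0 lambda4 lambda5 v /\ forall i, tau K n i v = alpha i.
Proof.
have inQ v := in_Q_prism_poly v lambda0P lambda4P lambda5P.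
have [b [g [d [e [c sol]]]]] := prism_poly_unisolvent alpha n_normal.
exists (prism_poly K b g d e c); split.
  by split; [apply/inQ; exists b, g, d, e, c | apply/sol].
move=> v [/inQ[b' [g' [d' [e' [c' ->]]]]] /sol[bE gE dE -> ->]].
by apply: eq_prism_poly => j; rewrite ?bE ?gE ?dE.
Qed.
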